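(* Let $d\ge 3$ be a real number and let $\alpha(d)$ be the largest real root of the equation $4x^{3}-(2d+1)x+d=0$. Let $G$ be a $C_4$-free graph with no isolated vertices. If $e(G)\ge \alpha(d)\,|G|$ and $\Delta(G)\le d$, then $\mathcal{E}(G)>|G|$.
   Context: All graphs are finite, simple and undirected, with at least one vertex. For a graph $G$: $|G|$ is its number of vertices, $e(G)$ its number of edges, and $\Delta(G)$ its maximum degree. $G$ is $C_4$-free if it contains no cycle of length $4$ as a (not necessarily induced) subgraph. If $|G|=n$ and $\mu_1\ge\cdots\ge\mu_n$ are the eigenvalues of the adjacency matrix of $G$ (with multiplicity), the energy of $G$ is $\mathcal{E}(G)=|\mu_1|+\cdots+|\mu_n|$. *)

(* Defs.v *)
From HB Require Import structures.
From mathcomp Require Import all_boot all_order all_algebra.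
From mathcomp Require Import reals polyrcf complex.

Set Implicit Arguments.
Unset Strict Implicit.
Unset Printing Implicit Defensive.

Import Order.TTheory GRing.Theory Num.Theory.
Local Open Scope ring_scope.

Record sgraph := SGraph {
  vertex :> finType;
  adj : rel vertex;
  adj_sym : symmetric adj;
  adj_irrefl : irreflexive adj
}.

Definition neighbours (G : sgraph) (x : G) : {set G} := [set y | adj x y].

Definition degree (G : sgraph) (x : G) : nat := #|neighbours x|.

Definition max_degree (G : sgraph) : nat := (\max_(x : G) degree x)%N.

Definition edges (G : sgraph) : {set {set G}} :=
  [set [set x; y] | x in G, y in neighbours x].

Definition num_edges (G : sgraph) : nat := #|edges G|.

Definition no_isolated_vertex (G : sgraph) : Prop :=
  forall x : G, (0 < degree x)%N.

Definition C4_free (G : sgraph) : Prop :=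
  forall c : 4.-tuple G, ~ ucycle (@adj G) c.

Definition adjmx (R : realType) (G : sgraph) : 'M[R]_#|G| :=
  \matrix_(i, j) (adj (enum_val i) (enum_val j))%:R.

(* The real roots of the characteristic polynomial, each repeated according to
   its algebraic multiplicity. *)
Definition eigenvalues (R : realType) (n : nat) (A : 'M[R]_n) : seq R :=
  flatten [seq nseq (mup x (char_poly A)) x | x <- rootsR (char_poly A)].

Definition energy (R : realType) (G : sgraph) : R :=
  \sum_(mu <- eigenvalues (adjmx R G)) `|mu|.

Definition largest_root (R : realType) (p : {poly R}) (a : R) : Prop :=
  root p a /\ forall x : R, root p x -> x <= a.

Lemma char_poly_similar (F : fieldType) n (P A B : 'M[F]_n) :
  P \in unitmx -> P *m A = B *m P -> char_poly A = char_poly B.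
Proof.
move=> uP PA; rewrite /char_poly.
have dP : \det (map_mx (@polyC F) P) != 0.
  by rewrite det_map_mx polyC_eq0 -unitfE -unitmxE.
have E : map_mx polyC P *m char_poly_mx A = char_poly_mx B *m map_mx polyC P.
  by rewrite /char_poly_mx mulmxBr mulmxBl -!map_mxM PA scalar_mxC.
by have := congr1 determinant E; rewrite !det_mulmx mulrC => /(mulIf dP).
Qed.

(* A real symmetric matrix has all its eigenvalues in R, so no eigenvalue is
   missing from the list [eigenvalues]. *)
Lemma symmetric_char_poly (R : realType) n (A : 'M[R]_n) : A^T = A ->
  char_poly A = \prod_(mu <- eigenvalues A) ('X - mu%:P).
Proof.
move=> symA.
pose toC : {rmorphism R -> R[i]} := real_complex R.
pose AC := map_mx toC A.
have hA : AC \is hermsymmx.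
  apply: realsym_hermsym.
    apply/is_hermitianmxP/matrixP => i j.
    by rewrite expr0 scale1r !mxE -{1}symA mxE.
  by apply/mxOverP => i j; rewrite mxE complex_real.
have [r rE] : exists r : 'I_n -> R, forall i, spectral_diag AC 0 i = toC (r i).
  exists (fun i => complex.Re (spectral_diag AC 0 i)) => i.
  by have /mxOverP/(_ 0 i)/complex_realP[x ->] := hermitian_spectral_diag_real hA.
have [s sE] : exists s : seq R, char_poly A = \prod_(x <- s) ('X - x%:P).
  exists [seq r i | i <- index_enum 'I_n]; rewrite big_map.
  apply: (map_poly_inj toC); rewrite map_char_poly rmorph_prod.
  have uP := spectral_unit AC.
  have /orthomx_spectralP Asp := hermitian_normalmx hA.
  rewrite (@char_poly_similar _ _ (spectralmx AC) _ (diag_mx (spectral_diag AC)) uP).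
    rewrite char_poly_trig ?diag_mx_is_trig //; apply: eq_bigr => i _.
    by rewrite rmorphB /= map_polyX map_polyC /= -rE mxE eqxx.
  by move: (congr1 (mulmx (spectralmx AC)) Asp); rewrite !mulmxA mulmxV // mul1mx.
have p0 : char_poly A != 0 by rewrite monic_neq0 ?char_poly_monic.
rewrite {1}sE; apply: perm_big; apply/allP => x _ /=; apply/eqP.
rewrite -mu_prod_XsubC -sE /eigenvalues; set p := char_poly A.
have rootE : (x \in rootsR p) = root p x.
  by have := roots_on_rootsR p0 x; rewrite in_itv /= => ->.
rewrite count_flatten -map_comp sumnE big_map /=.
under eq_bigr do rewrite count_nseq /=.
have [xr|xr] := boolP (x \in rootsR p).
  rewrite (bigD1_seq x) ?uniq_roots //= eqxx mul1n big1 ?addn0 // => y.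
  by move/negPf->.
rewrite mupNroot -?rootE // big1_seq // => y /= yr.
by case: eqP yr xr => // -> ->.
Qed.

(* Main.v *)
Require Import Defs.
From mathcomp Require Import all_boot all_order all_algebra.
From mathcomp Require Import reals.
From mathcomp Require Import polyrcf complex.
From mathcomp Require Import ring lra.

(** Let n be the number of vertices, m the number of edges, x = m / n, and let
    mu range over the eigenvalues of the adjacency matrix A.  For s > 0,

      2 s^3 |t| - 3 s^2 t^2 + t^4 = |t| (|t| - s)^2 (|t| + 2 s) >= 0,

    so the energy E satisfies 2 s^3 E >= 3 s^2 tr A^2 - tr A^4.  Here
    tr A^2 = 2 m, and since two distinct vertices have at most one common
    neighbour, tr A^4 is twice the sum of the squared degrees minus 2 m
    ([mxtrace_adjmx_exp4]).  All degrees lie in [1, d], so the sum of their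
    squares is at most (d + 1) 2 m - d n.  With s = 2 x, the average degree, the
    bound becomes

      16 x^3 E >= 16 x^3 n + 2 n (4 x^3 - (2 d + 1) x + d),

    and the cubic is nonnegative at x because x >= alpha.  Thus E >= n.

    For the strict inequality suppose E <= n.  Then every eigenvalue attains the
    quartic bound, and A^3 = s^2 A ([tight_energy_cube]).  Counting walks of
    length three then shows that each edge has an endpoint of degree 1
    ([edge_has_leaf_of_cube]), so G is a disjoint union of stars and m < n
    ([sum_degree_lt_of_leaves]).  But the cubic takes the value 3 - d <= 0 at 1,
    so alpha >= 1 and m >= n. *)

Set Implicit Arguments.
Unset Strict Implicit.
Unset Printing Implicit Defensive.

Import Order.TTheory GRing.Theory Num.Theory.
Local Open Scope ring_scope.

(** * Eigenvalues of a real symmetric matrix *)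

Lemma diag_mx_exp (R : comNzRingType) n (v : 'rV[R]_n) k :
  diag_mx v ^+ k = diag_mx (map_mx (fun x => x ^+ k) v).
Proof.
elim: k => [|k IH].
  by apply/matrixP => i j; rewrite expr0 !mxE expr0.
rewrite exprS IH -mulmxE mulmx_diag; congr diag_mx.
by apply/rowP => i; rewrite !mxE exprS.
Qed.

Lemma mxtrace_conj_exp (R : comUnitRingType) n (P B : 'M[R]_n) k :
  P \in unitmx -> \tr ((invmx P *m B *m P) ^+ k) = \tr (B ^+ k).
Proof.
move=> uP; suff -> : (invmx P *m B *m P) ^+ k = invmx P *m B ^+ k *m P.
  by rewrite mxtrace_mulC mulmxA mulmxV // mul1mx.
elim: k => [|k IH]; first by rewrite !expr0 mulmx1 mulVmx.
by rewrite !exprS IH -!mulmxE !mulmxA mulmxK.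
Qed.

Lemma prod_XsubC_perm_eq (F : fieldType) (s t : seq F) :
  \prod_(x <- s) ('X - x%:P) = \prod_(x <- t) ('X - x%:P) -> perm_eq s t.
Proof.
by move=> E; apply/allP => x _ /=; rewrite -!mu_prod_XsubC E.
Qed.

(** The spectral theorem diagonalizes A over R[i], and unique factorization of the
    characteristic polynomial matches the diagonal with the list of real roots. *)
Lemma sum_eigenvalues_exp (R : realType) n (A : 'M[R]_n) k : A^T = A ->
  \sum_(mu <- eigenvalues A) mu ^+ k = \tr (A ^+ k).
Proof.
move=> symA.
pose toC : {rmorphism R -> R[i]} := real_complex R.
pose AC := map_mx toC A.
have hA : AC \is hermsymmx.
  apply: realsym_hermsym.
    apply/is_hermitianmxP/matrixP => i j.
    by rewrite expr0 scale1r !mxE -{1}symA mxE.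
  by apply/mxOverP => i j; rewrite mxE complex_real.
have uP := spectral_unit AC.
have /orthomx_spectralP Asp := hermitian_normalmx hA.
set U := spectralmx AC in uP Asp; set v := spectral_diag AC in Asp.
have perm_spec :
    perm_eq [seq toC mu | mu <- eigenvalues A] [seq v 0 i | i <- index_enum 'I_n].
  apply: prod_XsubC_perm_eq; rewrite !big_map.
  transitivity (char_poly AC).
    rewrite -map_char_poly symmetric_char_poly // rmorph_prod.
    by apply: eq_bigr => mu _; rewrite rmorphB /= map_polyX map_polyC.
  rewrite (@char_poly_similar _ _ U _ (diag_mx v)) //.
    rewrite char_poly_trig ?diag_mx_is_trig //; apply: eq_bigr => i _.
    by rewrite mxE eqxx.
  by rewrite [in LHS]Asp !mulmxA mulmxV // mul1mx.
apply: (fmorph_inj toC); rewrite rmorph_sum /=.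
have -> : toC (\tr (A ^+ k)) = \tr (AC ^+ k).
  rewrite /AC -(rmorphXn (map_mx toC)) /= .
  by rewrite /mxtrace rmorph_sum; apply: eq_bigr => i _; rewrite mxE.
rewrite Asp mxtrace_conj_exp // diag_mx_exp mxtrace_diag.
transitivity (\sum_(z <- [seq toC mu | mu <- eigenvalues A]) z ^+ k).
  by rewrite big_map; apply: eq_bigr => mu _; rewrite rmorphXn.
by rewrite (perm_big _ perm_spec) big_map; apply: eq_bigr => i _; rewrite mxE.
Qed.

(** For a symmetric matrix the trace of the square is the sum of the squares of
    the entries. *)
Lemma symmetric_mx_eq0 (R : realDomainType) n (B : 'M[R]_n) :
  B^T = B -> \tr (B *m B) = 0 -> B = 0.
Proof.
move=> symB trB; apply/matrixP => i j; rewrite mxE.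
have diag_ge0 k : 0 <= (B *m B) k k.
  by rewrite mxE sumr_ge0 // => l _; rewrite -{2}symB mxE -expr2 sqr_ge0.
have : (B *m B) i i = 0 by apply: (psumr_eq0P _ trB).
rewrite mxE => /psumr_eq0P -/(_ _ j isT) => Bij.
apply/eqP; rewrite -sqrf_eq0 expr2 -{2}symB mxE; apply/eqP/Bij => l _.
by rewrite -{2}symB mxE -expr2 sqr_ge0.
Qed.

(** The even quartic 3 s^2 t^2 - t^4 meets 2 s^3 |t| at t = 0 and is tangent to it
    at |t| = s.  Summed over a spectrum, it bounds the energy from below by traces
    of powers, which count closed walks. *)
Lemma quartic_tangent_factor (R : realType) (s t : R) :
  2 * s ^+ 3 * `|t| - (3 * s ^+ 2 * t ^+ 2 - t ^+ 4) =
  `|t| * (`|t| - s) ^+ 2 * (`|t| + 2 * s).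
Proof.
by rewrite -[t ^+ 2]real_normK ?num_real // -[t ^+ 4]/(t ^+ (2 * 2))
  exprM -[t ^+ 2]real_normK ?num_real //; ring.
Qed.

(** Summing the quartic bound over the spectrum gives
    3 s^2 tr A^2 - tr A^4 <= 2 s^3 (sum of the |mu|); the hypothesis is the
    reverse inequality, so every eigenvalue attains the bound and satisfies
    mu^3 = s^2 mu.  As A is diagonalizable, the matrix obeys the same equation. *)
Lemma tight_energy_cube (R : realType) n (A : 'M[R]_n) (s : R) :
  A^T = A -> 0 < s ->
  2 * s ^+ 3 * \sum_(mu <- eigenvalues A) `|mu| <=
    3 * s ^+ 2 * \tr (A ^+ 2) - \tr (A ^+ 4) ->
  A ^+ 3 = s ^+ 2 *: A.
Proof.
move=> symA s0; rewrite -subr_le0.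
rewrite -!sum_eigenvalues_exp // !mulr_sumr -!sumrB.
under eq_bigr do rewrite quartic_tangent_factor.
have term_ge0 (mu : R) : 0 <= `|mu| * (`|mu| - s) ^+ 2 * (`|mu| + 2 * s).
  apply: mulr_ge0; first by rewrite mulr_ge0 ?sqr_ge0.
  by rewrite addr_ge0 // mulr_ge0 // ltW.
move=> le0.
have {le0} : \sum_(mu <- eigenvalues A)
    `|mu| * (`|mu| - s) ^+ 2 * (`|mu| + 2 * s) == 0.
  by rewrite eq_le le0 sumr_ge0.
rewrite psumr_eq0 // => /allP all0.
have cubic mu : mu \in eigenvalues A -> mu ^+ 3 = s ^+ 2 * mu.
  move=> /all0 /=; rewrite mulf_eq0 mulf_eq0 -orbA => /or3P[||].
  - by rewrite normr_eq0 => /eqP ->; rewrite mulr0 expr0n.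
  - rewrite sqrf_eq0 subr_eq0 => /eqP <-.
    by rewrite real_normK ?num_real // -exprSr.
  - by rewrite gt_eqF // ltr_wpDl ?mulr_gt0.
apply/eqP; rewrite -subr_eq0; apply/eqP/symmetric_mx_eq0.
  by rewrite linearB /= linearZ /= !exprS expr0 mulr1 -!mulmxE !trmx_mul symA mulmxA.
(* By the power sums, the trace of the square of A^3 - s^2 A is the sum of the
   (mu^3 - s^2 mu)^2, which vanishes. *)
have -> : (A ^+ 3 - s ^+ 2 *: A) *m (A ^+ 3 - s ^+ 2 *: A) =
    A ^+ 6 - (2 * s ^+ 2) *: A ^+ 4 + s ^+ 4 *: A ^+ 2.
  rewrite mulmxBl !mulmxBr -!scalemxAl -!scalemxAr scalerA !mulmxE.
  rewrite -!exprD -exprS -exprSr opprB [_ - s ^+ 2 *: _ in X in _ + X]addrC.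
  by rewrite mulr_natl mulr2n scalerDl opprD !addrA.
rewrite raddfD raddfB /= !linearZ /= -!sum_eigenvalues_exp // !mulr_sumr.
rewrite -sumrB -big_split /= big1_seq // => mu /andP[_ /cubic mu3].
have -> : mu ^+ 6 = (mu ^+ 3) ^+ 2 by rewrite -exprM.
by rewrite (exprSr mu 3) mu3; ring.
Qed.

(** * Counting walks in a graph without 4-cycles *)

Lemma sum_degree (G : sgraph) :
  (\sum_(x : G) degree x = 2 * num_edges G)%N.
Proof.
transitivity (\sum_(p : G * G | adj p.1 p.2) 1)%N.
  rewrite -(pair_big_dep xpredT (fun x y => adj x y) (fun _ _ => 1%N)) /=.
  by apply: eq_bigr => x _; rewrite sum1_card /degree cardsE.
(* Group the ordered adjacent pairs by their edge: each edge comes from two. *)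
rewrite (partition_big (fun p => [set p.1; p.2]) (mem (edges G))) /=; last first.
  by move=> [x y] /= xy; apply/imset2P; exists x y; rewrite ?inE.
rewrite mulnC -sum_nat_const; apply: eq_bigr => e /imset2P[x y _].
rewrite inE => xy ->; have nxy : x != y.
  by apply: contraTneq xy => ->; rewrite adj_irrefl.
have <- : #|[set (x, y); (y, x)]| = 2%N by rewrite cards2 xpair_eqE negb_and nxy.
rewrite sum1_card; apply: eq_card => -[u v]; rewrite !inE unfold_in /= !xpair_eqE.
apply/andP/orP => [[uv /eqP/setP E]|].
  have := E u; have := E v; rewrite !inE !eqxx orbT /=.
  have nuv : u != v by apply: contraTneq uv => ->; rewrite adj_irrefl.
  move=> /esym/orP[] /eqP vE /esym/orP[] /eqP uE; move: nuv; rewrite uE vE !eqxx //.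
    by right.
  by left.
by case=> /andP[/eqP -> /eqP ->]; split; rewrite // 1?adj_sym // setUC.
Qed.

(** Two common neighbours u, v of x and y would close the 4-cycle x u y v. *)
Lemma C4_free_codegree (G : sgraph) (x y : G) : C4_free G -> x != y ->
  (#|neighbours x :&: neighbours y| <= 1)%N.
Proof.
move=> c4 nxy; apply/card_le1_eqP => u v; rewrite !inE => /andP[xu yu] /andP[xv yv].
apply/eqP/negPn/negP => nuv; apply: (c4 [tuple x; u; y; v]).
have ne (a b : G) : adj a b -> a != b.
  by apply: contraTneq => ->; rewrite adj_irrefl.
rewrite /ucycle /= xu [adj u y]adj_sym yu yv [adj v x]adj_sym xv /=.
by rewrite !inE !negb_or (ne _ _ xu) nxy (ne _ _ xv)
  [u == y]eq_sym (ne _ _ yu) [u == v]eq_sym nuv (ne _ _ yv).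
Qed.

Lemma adjmx_sym (R : realType) (G : sgraph) : (adjmx R G)^T = adjmx R G.
Proof. by apply/matrixP => i j; rewrite !mxE adj_sym. Qed.

Lemma sum_adj (R : pzSemiRingType) (G : sgraph) (x : G) :
  \sum_(y : G) (adj x y)%:R = (degree x)%:R :> R.
Proof.
by rewrite -natr_sum /degree -sum1_card; congr _%:R; rewrite [RHS]big_mkcond /=;
  apply: eq_bigr => y _; rewrite inE; case: adj.
Qed.

Lemma sum_enum_val (R : nmodType) (T : finType) (F : T -> R) :
  \sum_(i < #|T|) F (enum_val i) = \sum_x F x.
Proof. by rewrite -big_enum_val. Qed.

Lemma adjmx_sqr (R : realType) (G : sgraph) i j :
  (adjmx R G ^+ 2) i j =
  #|neighbours (enum_val i) :&: neighbours (enum_val j)|%:R.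
Proof.
rewrite expr2 -mulmxE mxE.
under eq_bigr do rewrite !mxE [adj _ (enum_val j)]adj_sym -natrM mulnb.
rewrite (sum_enum_val (fun x => (adj (enum_val i) x && adj (enum_val j) x)%:R : R)).
rewrite -natr_sum -sum1_card; congr _%:R; rewrite [RHS]big_mkcond /=.
by apply: eq_bigr => y _; rewrite !inE; case: (_ && _).
Qed.

Lemma adjmx_mul_degree (R : realType) (G : sgraph) :
  adjmx R G *m const_mx 1 = \col_i (degree (enum_val i))%:R.
Proof.
apply/colP => i; rewrite !mxE; under eq_bigr do rewrite !mxE mulr1.
by rewrite (sum_enum_val (fun x => (adj (enum_val i) x)%:R : R)) sum_adj.
Qed.

Lemma sum_adj_sym (R : pzSemiRingType) (G : sgraph) (f : G -> R) :
  \sum_(x : G) \sum_(y : G) (adj x y)%:R * f y =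
  \sum_(x : G) (degree x)%:R * f x.
Proof.
rewrite exchange_big; apply: eq_bigr => y _.
by rewrite -mulr_suml -sum_adj; congr (_ * _); apply: eq_bigr => x _; rewrite adj_sym.
Qed.

Lemma mxtrace_adjmx_sqr (R : realType) (G : sgraph) :
  \tr (adjmx R G ^+ 2) = \sum_(x : G) (degree x)%:R.
Proof.
rewrite -sum_enum_val; apply: eq_bigr => i _.
by rewrite adjmx_sqr setIid.
Qed.

(** tr A^4 is the sum of the squared codegrees.  The codegree of two distinct
    vertices is 0 or 1, hence equal to its square, so only the diagonal terms
    deg(x)^2 differ from the sum of the codegrees, which is the sum of the
    deg(z)^2 by counting paths x z y from their middle. *)
Lemma mxtrace_adjmx_exp4 (R : realType) (G : sgraph) : C4_free G ->
  \tr (adjmx R G ^+ 4) =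
  2 * \sum_(x : G) (degree x)%:R ^+ 2 - \sum_(x : G) (degree x)%:R.
Proof.
move=> c4; pose c (x y : G) : R := #|neighbours x :&: neighbours y|%:R.
have sum_c : \sum_x \sum_y c x y = \sum_(x : G) (degree x)%:R ^+ 2.
  transitivity (\sum_(x : G) \sum_(z : G) (adj x z)%:R * (degree z)%:R : R).
    apply: eq_bigr => x _.
    transitivity (\sum_(y : G) \sum_(z : G) (adj x z)%:R * (adj z y)%:R : R).
      apply: eq_bigr => y _; rewrite /c -sum1_card natr_sum big_mkcond /=.
      apply: eq_bigr => z _; rewrite !inE -natrM mulnb [adj z y]adj_sym.
      by case: (_ && _).
    by rewrite exchange_big; apply: eq_bigr => z _; rewrite -mulr_sumr sum_adj.
  by rewrite sum_adj_sym; apply: eq_bigr => x _; rewrite expr2.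
have c_sqr x y : c x y ^+ 2 =
    c x y + (x == y)%:R * ((degree x)%:R ^+ 2 - (degree x)%:R).
  have [->|nxy] := eqVneq x y.
    by rewrite /c setIid mul1r addrC subrK.
  rewrite mul0r addr0 /c.
  by case: #|_| (C4_free_codegree c4 nxy) => [|[]] // _; rewrite ?expr0n ?expr1n.
transitivity (\sum_x \sum_y c x y ^+ 2).
  rewrite -[RHS]sum_enum_val; apply: eq_bigr => i _.
  rewrite -[4%N]/(2 + 2)%N exprD -mulmxE mxE -[RHS]sum_enum_val.
  by apply: eq_bigr => j _; rewrite !adjmx_sqr [in X in _ * X]setIC -expr2.
transitivity (\sum_x (\sum_y c x y + ((degree x)%:R ^+ 2 - (degree x)%:R))).
  apply: eq_bigr => x _; under eq_bigr do rewrite c_sqr.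
  rewrite big_split; congr (_ + _).
  rewrite (bigD1 x) //= eqxx mul1r big1 ?addr0 // => y.
  by rewrite eq_sym => /negPf ->; rewrite mul0r.
rewrite big_split /= sum_c sumrB; ring.
Qed.

(** A degree k lies between 1 and d, so (k - 1)(d - k) >= 0. *)
Lemma sum_degree_sqr_le (R : realFieldType) (G : sgraph) (d : R) :
  no_isolated_vertex G -> (max_degree G)%:R <= d ->
  \sum_(x : G) (degree x)%:R ^+ 2 <=
    (d + 1) * (\sum_(x : G) (degree x)%:R) - d * #|G|%:R.
Proof.
move=> iso max_d.
have -> : d * #|G|%:R = \sum_(x : G) d by rewrite sumr_const mulr_natr.
rewrite mulr_sumr -sumrB; apply: ler_sum => x _.
have D1 : 1 <= (degree x)%:R :> R by rewrite ler1n iso.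
have Dd : (degree x)%:R <= d.
  by apply: le_trans max_d; rewrite ler_nat (leq_bigmax x).
nra.
Qed.

(** * Equality in the spectral bound *)

(** An edge xy with a leaf has 1/deg(x) + 1/deg(y) > 1, while the left-hand side
    summed over all edges gives each vertex a total weight 1.  Equivalently, the
    components are stars. *)
Lemma sum_degree_lt_of_leaves (R : realFieldType) (G : sgraph) :
  (0 < #|G|)%N -> no_isolated_vertex G ->
  (forall x y : G, adj x y -> (degree x == 1%N) || (degree y == 1%N)) ->
  \sum_(x : G) (degree x)%:R < 2 * #|G|%:R :> R.
Proof.
move=> G0 iso leafy.
have deg_neq0 (x : G) : (degree x)%:R != 0 :> R by rewrite pnatr_eq0 -lt0n.
have inv_sum : \sum_(x : G) \sum_(y : G) (adj x y)%:R * (degree y)%:R^-1 = #|G|%:R :> R.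
  rewrite (sum_adj_sym (fun y => (degree y)%:R^-1)).
  under eq_bigr do rewrite mulfV //.
  by rewrite sumr_const.
have -> : 2 * #|G|%:R = \sum_(x : G) \sum_(y : G)
   (adj x y)%:R * ((degree x)%:R^-1 + (degree y)%:R^-1) :> R.
  under eq_bigr => x _ do under eq_bigr => y _ do rewrite mulrDr.
  under eq_bigr => x _ do rewrite big_split /= -mulr_suml sum_adj mulfV //.
  by rewrite big_split /= inv_sum sumr_const mulr2n mulrDl mul1r.
have /card_gt0P[x0 _] := G0.
have edge_lt (x y : G) : adj x y ->
    1 < (degree x)%:R^-1 + (degree y)%:R^-1 :> R.
  have inv_gt0 (z : G) : 0 < (degree z)%:R^-1 :> R by rewrite invr_gt0 ltr0n.
  by move=> /leafy /orP[] /eqP ->; rewrite invr1 ?ltrDl ?ltrDr.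
under eq_bigr do rewrite -sum_adj.
have le_edge (x y : G) : (adj x y)%:R <=
    (adj x y)%:R * ((degree x)%:R^-1 + (degree y)%:R^-1) :> R.
  case: (boolP (adj x y)) => [/edge_lt/ltW|_]; by rewrite ?mul1r ?mul0r.
have le_row (x : G) : \sum_(y : G) (adj x y)%:R <=
   \sum_(y : G) (adj x y)%:R * ((degree x)%:R^-1 + (degree y)%:R^-1) :> R.
  by apply: ler_sum.
have /card_gt0P[y0] := iso x0; rewrite inE => xy0.
rewrite (bigD1 x0) //= [ltRHS](bigD1 x0) //=; apply: ltr_leD; last exact: ler_sum.
rewrite (bigD1 y0) //= [ltRHS](bigD1 y0) //=; apply: ltr_leD; last exact: ler_sum.
by rewrite xy0 mul1r edge_lt.
Qed.

(** Two consequences of A^3 = c A are compared: the entries of A^3 sum to the sum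
    over ordered edges of deg(x) deg(y), and tr A^4 = c tr A^2 is the sum over
    ordered edges of deg(x) + deg(y) - 1.  Both equal c times the sum of the
    degrees, so the nonnegative quantities (deg(x) - 1)(deg(y) - 1) add up to 0. *)
Lemma edge_has_leaf_of_cube (R : realType) (G : sgraph) (c : R) :
  C4_free G -> no_isolated_vertex G ->
  adjmx R G ^+ 3 = c *: adjmx R G ->
  forall x y : G, adj x y -> (degree x == 1%N) || (degree y == 1%N).
Proof.
move=> c4 iso cubic.
pose D (x : G) : R := (degree x)%:R.
have D_ge1 x : 0 <= D x - 1 by rewrite subr_ge0 ler1n iso.
have row_sum x : \sum_(y : G) (adj x y)%:R = D x := sum_adj R x.
have walks3 : \sum_x \sum_y (adj x y)%:R * (D x * D y) = c * \sum_x D x.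
  (* u^T B u is the sum of the entries of B. *)
  pose u : 'cV[R]_#|G| := const_mx 1.
  have Au := adjmx_mul_degree R G; rewrite -/u in Au.
  have uA : u^T *m adjmx R G = (\col_i D (enum_val i))^T.
    by rewrite -Au trmx_mul adjmx_sym.
  have := congr1 (fun B => (u^T *m B *m u) 0 0) cubic.
  rewrite exprS expr2 -!mulmxE !mulmxA uA -[_ *m _ *m u]mulmxA Au.
  rewrite -scalemxAr -scalemxAl uA !mxE.
  under [X in X = _]eq_bigr => j _ do rewrite [(\col_i _) j 0]mxE.
  move=> E.
  transitivity (c * \sum_(i < #|G|) D (enum_val i)); last by rewrite sum_enum_val.
  transitivity (\sum_(j < #|G|)
      ((\col_i D (enum_val i))^T *m adjmx R G) 0 j * D (enum_val j)).
    rewrite exchange_big -sum_enum_val; apply: eq_bigr => j _.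
    rewrite mxE mulr_suml -sum_enum_val; apply: eq_bigr => i _.
    by rewrite !mxE; ring.
  transitivity (c * \sum_(j < #|G|) (\col_i D (enum_val i))^T 0 j * u j 0).
    exact: E.
  by congr (_ * _); apply: eq_bigr => j _; rewrite !mxE mulr1.
have walks4 : 2 * \sum_x D x ^+ 2 - \sum_x D x = c * \sum_x D x.
  rewrite -(mxtrace_adjmx_exp4 R c4) -(mxtrace_adjmx_sqr R G) -linearZ /=.
  by rewrite exprSr cubic expr2 -!mulmxE scalemxAl.
have : \sum_x \sum_y (adj x y)%:R * ((D x - 1) * (D y - 1)) = 0.
  transitivity (\sum_x (\sum_y (adj x y)%:R * (D x * D y) - D x ^+ 2 + D x
      - \sum_y (adj x y)%:R * D y)).
    apply: eq_bigr => x _; rewrite expr2 -[X in _ - D x * X]row_sum.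
    rewrite -[X in _ + X - _]row_sum mulr_sumr -!sumrB -big_split -sumrB /=.
    by apply: eq_bigr => y _; ring.
  rewrite sumrB big_split sumrB /= walks3 sum_adj_sym -walks4.
  under [X in _ - X]eq_bigr do rewrite -expr2.
  ring.
have term_ge0 x y : 0 <= (adj x y)%:R * ((D x - 1) * (D y - 1)).
  by rewrite !mulr_ge0.
move=> /psumr_eq0P sum0 x y xy.
have /psumr_eq0P/(_ y isT) := sum0 (fun x _ => sumr_ge0 _ (fun y _ => term_ge0 x y)) x isT.
move=> /(_ (fun y _ => term_ge0 x y)) /eqP.
by rewrite xy mul1r mulf_eq0 !subr_eq0 !pnatr_eq1.
Qed.

(** * The cubic and its largest root *)

(** The intermediate value theorem gives a root between x and y, and this root is
    at most a. *)
Lemma largest_root_ge (R : realType) (p : {poly R}) (a x y : R) :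
  largest_root p a -> p.[x] <= 0 -> x <= y -> 0 <= p.[y] -> x <= a.
Proof.
move=> [_ max_a] px xy py.
have [z /andP[xz _] /max_a] : exists2 z, x <= z <= y & root p z.
  by apply: poly_ivt; rewrite // px.
exact: le_trans.
Qed.

(** * Graphs with energy above their order *)

Theorem theorem3 (R : realType) (d alpha : R) (G : sgraph) :
  3 <= d ->
  largest_root (4 *: 'X^3 - (2 * d + 1) *: 'X + d%:P) alpha ->
  (0 < #|G|)%N ->
  C4_free G ->
  no_isolated_vertex G ->
  alpha * #|G|%:R <= (num_edges G)%:R ->
  (max_degree G)%:R <= d ->
  #|G|%:R < energy R G.
Proof.
move=> d3; set p := (X in largest_root X _) => root_alpha G0 c4 iso dense max_d.
have pE x : p.[x] = 4 * x ^+ 3 - (2 * d + 1) * x + d by rewrite /p !hornerE.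
set n : R := #|G|%:R in dense *; set m : R := (num_edges G)%:R in dense.
have n0 : 0 < n by rewrite ltr0n.
(* Use p.[y] = y (4 y^2 - (2 d + 1)) + d. *)
have p_ge0 y : d <= y -> 0 <= p.[y].
  move=> dy; rewrite pE; have : 0 <= y * (4 * y ^+ 2 - (2 * d + 1)); last by lra.
  by apply: mulr_ge0; nra.
(* p.[1] = 3 - d <= 0. *)
have alpha1 : 1 <= alpha.
  apply: (largest_root_ge (y := d) root_alpha); [rewrite pE; lra | lra | exact: p_ge0].
pose x := m / n.
have mE : m = x * n by rewrite /x divfK ?gt_eqF.
have x_ge : alpha <= x by rewrite ler_pdivlMr.
have px : 0 <= p.[x].
  rewrite leNgt; apply/negP => px0.
  have x_le : x <= alpha.
    apply: (largest_root_ge (y := x + d) root_alpha); [exact: ltW | lra | apply: p_ge0].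
    by have := le_trans alpha1 x_ge; lra.
  have xE : x = alpha by apply: le_anti; rewrite x_le.
  by move: px0; rewrite xE; case: root_alpha => /eqP ->; rewrite ltxx.
have sumD : \sum_(z : G) (degree z)%:R = 2 * m :> R.
  by rewrite -natr_sum sum_degree natrM.
rewrite ltNge; apply/negP => energy_le.
have x1 : 1 <= x := le_trans alpha1 x_ge.
(* Why the tangency point is s = 2 x: if every nonzero |mu| is s and the energy
   is n, then 2 m = tr A^2 = s n. *)
have cubic : adjmx R G ^+ 3 = (2 * x) ^+ 2 *: adjmx R G.
  apply: tight_energy_cube; [exact: adjmx_sym|by lra|].
  rewrite mxtrace_adjmx_exp4 // mxtrace_adjmx_sqr.
  have := sum_degree_sqr_le iso max_d; rewrite sumD -/n.
  set Q := \sum_(z : G) _ => Q_le.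
  apply: (@le_trans _ _ (2 * (2 * x) ^+ 3 * n)).
    by apply: ler_wpM2l energy_le; rewrite mulr_ge0 ?exprn_ge0 //; lra.
  (* What remains is 2 n p.[x] >= 0. *)
  move: px; rewrite pE => px; have := mulr_ge0 (ltW n0) px.
  rewrite mE in Q_le *; nra.
have := sum_degree_lt_of_leaves R G0 iso (edge_has_leaf_of_cube c4 iso cubic).
rewrite sumD -/n mE; nra.
Qed.
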